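(* Let $(\Omega)$ be the generating tree with root labeled $(2)$ and succession rule $(k)\rightsquigarrow(k+1)(k-1)(k-2)\cdots(2)(1)$, the root being at level $1$. For every $n\ge1$, level $n$ of $(\Omega)$ can be coded by the permutations in $S_{n+1}(132)$ without any factor $a(a+1)$, the root being coded by the permutation $21$.
   Context: $S_n(132)$ is the set of permutations $\pi=\pi_1\cdots\pi_n$ of $\{1,\dots,n\}$ with no $i<j<k$ such that $\pi_i<\pi_k<\pi_j$. A factor $a(a+1)$ in $\pi$ is a pair of adjacent entries $\pi_i=a$, $\pi_{i+1}=a+1$. Succession rule: a node labeled $(k)$ has exactly $k$ children, with labels $k+1,k-1,k-2,\dots,2,1$ (so a node labeled $(1)$ has a single child, labeled $(2)$). Coding a generating tree by permutations: for a permutation $\pi$ of length $m$, its sites are numbered from left to right $1,\dots,m+1$, and $\pi^{\downarrow i}$ is the permutation obtained by inserting $m+1$ into the $i$-th site. For the class $\mathcal C$ of $132$-avoiding permutations without any factor $a(a+1)$, site $i$ of $\pi\in\mathcal C$ is active if $\pi^{\downarrow i}\in\mathcal C$. That the levels of $(\Omega)$ are coded by $\mathcal C$ with root $21$ means: the nodes of $(\Omega)$ can be identified with permutations so that the root is $21$; the children of a node $\pi$ are exactly the permutations $\pi^{\downarrow i}$ with $i$ an active site of $\pi$; the label of $\pi$ is its number of active sites (hence the children of a $\pi$ with $k$ active sites have $k+1,k-1,\dots,2,1$ active sites in some order); and the nodes at level $n$ are exactly the permutations of length $n+1$ in $\mathcal C$, each occurring once. *)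

(* Defs.v *)
From mathcomp Require Import all_boot all_fingroup.

Set Implicit Arguments.
Unset Strict Implicit.
Unset Printing Implicit Defensive.

(* Generating trees.  A succession rule sends a label to the list of the labels
   of the children.  A node is given by the path leading to it: a sequence of
   (0-based) child indices, most recent choice first, so that [::] is the root
   and i :: p is the i-th child of p. *)

Fixpoint path_label (rule : nat -> seq nat) (root : nat) (p : seq nat) : nat :=
  if p is i :: q then nth 0 (rule (path_label rule root q)) i else root.

Fixpoint is_node (rule : nat -> seq nat) (root : nat) (p : seq nat) : bool :=
  if p is i :: q then
    is_node rule root q && (i < size (rule (path_label rule root q)))
  else true.

(* The root is at level 1; there is no node at level 0. *)
Definition node (rule : nat -> seq nat) (root n : nat) : Type :=
  {p : seq nat | is_node rule root p && ((size p).+1 == n)}.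

Definition root_node (rule : nat -> seq nat) (root : nat) : node rule root 1 :=
  exist _ [::] isT.

Definition label (rule : nat -> seq nat) (root n : nat)
    (x : node rule root n) : nat := path_label rule root (val x).

Definition child_of (rule : nat -> seq nat) (root n : nat)
    (y : node rule root n.+1) (x : node rule root n) : Prop :=
  exists i : nat, val y = i :: val x.

(* (k) ~> (k+1)(k-1)(k-2)...(2)(1) *)
Definition omega_rule (k : nat) : seq nat := k.+1 :: rev (iota 1 k.-1).

(* Permutations.  Positions, sites and values are 0-based. *)

Definition avoids132 (n : nat) (s : 'S_n) : bool :=
  [forall i : 'I_n, forall j : 'I_n, forall k : 'I_n,
     (i < j < k) ==> ~~ (s i < s k < s j)].

Definition has_succ_factor (n : nat) (s : 'S_n) : bool :=
  [exists i : 'I_n, exists j : 'I_n,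
     (j == i.+1 :> nat) && (s j == (s i).+1 :> nat)].

Definition classC (n : nat) : {set 'S_n} :=
  [set s : 'S_n | avoids132 s && ~~ has_succ_factor s].

(* ord_max is the new value; it is placed at position i and the entries of s
   at positions >= i are shifted one step to the right. *)
Definition insert_max (n : nat) (s : 'S_n) (i : 'I_n.+1) : 'S_n.+1 :=
  lift_perm i ord_max s.

Definition active_sites (n : nat) (s : 'S_n) : {set 'I_n.+1} :=
  [set i : 'I_n.+1 | insert_max s i \in classC n.+1].

Definition perm21 : 'S_2 := tperm ord0 ord_max.

(* Main.v *)
(* Call site i of s a cut if every entry to its left exceeds every entry to its
   right; inserting the maximum at i preserves 132-avoidance iff i is a cut.  If
   p is the position of the maximum of s in C, then 0 and p+1 are its first two
   cuts, and inserting at p+1 is the only way to create a factor a (a+1) at a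
   cut: the active sites are the cuts other than p+1.  Inserting at a cut i turns
   the cuts j >= i into the cuts j+1 of the new permutation and leaves 0 as the
   only other cut.  Hence, with k active sites in increasing order, inserting at
   the first one gives k+1 active sites, and at the r-th one (r > 1, so that the
   site lies beyond p+1) gives k+1-r: this is the rule (Omega), in order. *)
Require Import Defs.
From mathcomp Require Import all_boot all_fingroup zify.

Set Implicit Arguments.
Unset Strict Implicit.
Unset Printing Implicit Defensive.

(** * Cuts of a permutation *)

Definition is_cut (n : nat) (s : 'S_n) (i : nat) : bool :=
  [forall a : 'I_n, forall b : 'I_n, (a < i <= b) ==> (s b < s a)].

Lemma is_cutP (n : nat) (s : 'S_n) (i : nat) :
  reflect (forall a b : 'I_n, a < i <= b -> s b < s a) (is_cut s i).
Proof.
apply: (iffP forallP) => [H a b | H a].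
  by move/(_ a)/forallP/(_ b)/implyP: H.
by apply/forallP=> b; apply/implyP/H.
Qed.

Lemma avoids132P (n : nat) (s : 'S_n) :
  reflect (forall i j k : 'I_n, i < j < k -> ~~ (s i < s k < s j))
          (avoids132 s).
Proof.
apply: (iffP forallP) => [H i j k | H i].
  by move/(_ i)/forallP/(_ j)/forallP/(_ k)/implyP: H.
by apply/forallP=> j; apply/forallP=> k; apply/implyP/H.
Qed.

Lemma has_succ_factorP (n : nat) (s : 'S_n) :
  reflect (exists i j : 'I_n, j = i.+1 :> nat /\ s j = (s i).+1 :> nat)
          (has_succ_factor s).
Proof.
apply: (iffP existsP) =>
    [[i /existsP[j /andP[/eqP ? /eqP ?]]] | [i [j [ji sji]]]].
  by exists i, j.
by exists i; apply/existsP; exists j; rewrite ji sji !eqxx.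
Qed.

Lemma is_cut0 (n : nat) (s : 'S_n) : is_cut s 0.
Proof. by apply/is_cutP. Qed.

Lemma perm_nat_neq (n : nat) (s : 'S_n) (a b : 'I_n) :
  a != b :> nat -> s a != s b :> nat.
Proof. by apply: contraNneq => /val_inj/perm_inj ->. Qed.

(** * Effect of inserting the maximum on 132-avoidance and on cuts *)

Section Insertion.

Variables (n : nat) (s : 'S_n) (i : 'I_n.+1).

Lemma insert_max_site : insert_max s i i = n :> nat.
Proof. by rewrite /insert_max lift_perm_id. Qed.

Lemma insert_max_lift (a : 'I_n) : insert_max s i (lift i a) = s a :> nat.
Proof. by rewrite /insert_max lift_perm_lift lift_max. Qed.

Lemma insert_max_inv : (insert_max s i)^-1%g ord_max = i.
Proof. by apply: (canLR (permK _)); rewrite /insert_max lift_perm_id. Qed.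

(** In an occurrence of 132 the new maximum can only play the 3. The 1 and the 2 are then an entry
    left of [i] and a larger entry right of it, which is exactly what a cut forbids. *)
Lemma avoids132_insert_max :
  avoids132 (insert_max s i) = avoids132 s && is_cut s i.
Proof.
have valL (a : 'I_n) : lift i a = (i <= a) + a :> nat by [].
apply/avoids132P/andP => [H | [/avoids132P avs /is_cutP cuts] x y z].
  split.
    apply/avoids132P => a b c abc.
    have := H (lift i a) (lift i b) (lift i c).
    by rewrite !insert_max_lift; apply; rewrite !valL; lia.
  apply/is_cutP => a b aib.
  have := H (lift i a) i (lift i b).
  rewrite !insert_max_lift insert_max_site !valL => /(_ ltac:(lia)).
  have sb := ltn_ord (s b).
  by have := @perm_nat_neq _ s a b; lia.
case: (unliftP i x) => [a|] ->; rewrite ?insert_max_lift ?insert_max_site ?valL;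
case: (unliftP i y) => [b|] ->; rewrite ?insert_max_lift ?insert_max_site ?valL;
case: (unliftP i z) => [c|] ->; rewrite ?insert_max_lift ?insert_max_site ?valL;
  try lia.
- by move=> abc; apply: avs; lia.
- by move=> _; have := ltn_ord (s b); lia.
- by move=> aic; have := cuts a c; lia.
by move=> _; have := ltn_ord (s c); lia.
Qed.

(** A site [j] with [0 < j <= i] has the first entry on its left and the new maximum on its
    right. *)
Lemma is_cut_insert_max (j : nat) :
  is_cut (insert_max s i) j -> j <= i -> j = 0.
Proof.
case: j => // j /is_cutP/(_ ord0 i) /=.
rewrite insert_max_site => H ji; have := ltn_ord (insert_max s i ord0).
by have := H ji; lia.
Qed.

(** The new maximum joins the left side of the cut, where it exceeds everything on the right
    anyway. *)
Lemma is_cut_insert_maxS (j : nat) :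
  i <= j -> is_cut (insert_max s i) j.+1 = is_cut s j.
Proof.
have valL (a : 'I_n) : lift i a = (i <= a) + a :> nat by [].
move=> ij; apply/is_cutP/is_cutP => H.
  move=> a b ajb; have := H (lift i a) (lift i b).
  by rewrite !insert_max_lift !valL; apply; lia.
move=> x y.
case: (unliftP i x) => [a|] ->; rewrite ?insert_max_lift ?insert_max_site ?valL;
case: (unliftP i y) => [b|] ->; rewrite ?insert_max_lift ?insert_max_site ?valL;
  try lia.
- by move=> ajb; apply: H; lia.
by move=> _; apply: ltn_ord.
Qed.

End Insertion.

(** * Factors [a (a+1)] and active sites *)

Lemma has_succ_insert_max (n : nat) (s : 'S_n.+1) (i : 'I_n.+2) :
  ~~ has_succ_factor s ->
  has_succ_factor (insert_max s i) = (i == (s^-1%g ord_max).+1 :> nat).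
Proof.
have valL (a : 'I_n.+1) : lift i a = (i <= a) + a :> nat by [].
move=> nf; apply/has_succ_factorP/eqP => [[x [y []]] | ip].
  case: (unliftP i x) => [a|] ->; rewrite ?insert_max_lift ?insert_max_site ?valL;
  case: (unliftP i y) => [b|] ->; rewrite ?insert_max_lift ?insert_max_site ?valL;
    try lia.
  (* Old entries adjacent after the insertion were already adjacent in [s]. *)
  - move=> ba sba; case/negP: nf; apply/has_succ_factorP; exists a, b.
    split=> //; have : a != b :> nat.
      by apply: contra_eqN sba => /eqP/val_inj ->; lia.
    lia.
  (* The entry just before the new maximum has to be the old maximum. *)
  - move=> ia sa; suff <- : a = s^-1%g ord_max by lia.
    by apply: (@perm_inj _ s); rewrite permKV; apply: val_inj => /=; lia.
  by move=> _; have := ltn_ord (s b); lia.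
exists (lift i (s^-1%g ord_max)), i.
by rewrite insert_max_lift insert_max_site valL permKV /=; lia.
Qed.

(* An adjacent pair a (a+1) cannot be destroyed at a cut, since this would
   create the pattern a m (a+1). *)
Lemma has_succ_of_insert_max (n : nat) (s : 'S_n) (i : 'I_n.+1) :
  is_cut s i -> has_succ_factor s -> has_succ_factor (insert_max s i).
Proof.
move=> /is_cutP cuts /has_succ_factorP[a [b [ba sba]]].
apply/has_succ_factorP; exists (lift i a), (lift i b).
rewrite !insert_max_lift; split=> //=; rewrite /bump.
by have := cuts a b; lia.
Qed.

(** The class is closed under removal of the maximum, because a factor of [s] would survive
    insertion at a cut. This closure drives the induction in [code_onto]. *)
Lemma classC_insert_max (n : nat) (s : 'S_n.+1) (i : 'I_n.+2) :
  (insert_max s i \in classC n.+2) =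
  [&& s \in classC n.+1, is_cut s i & i != (s^-1%g ord_max).+1 :> nat].
Proof.
rewrite !inE avoids132_insert_max.
case: (boolP (is_cut s i)) => [ci|]; last by rewrite !andbF.
rewrite !andbT -!andbA; congr (_ && _).
case: (boolP (has_succ_factor s)) => [f|nf]; last by rewrite has_succ_insert_max.
by rewrite has_succ_of_insert_max.
Qed.

(** * Counting active sites through cuts *)

Definition cuts (n : nat) (s : 'S_n) : {set 'I_n.+1} :=
  [set i : 'I_n.+1 | is_cut s i].

(** An entry before the maximum and a larger one after it would form a 132 with the maximum as the
    3. *)
Lemma is_cut_max (n : nat) (s : 'S_n.+1) :
  avoids132 s -> is_cut s (s^-1%g ord_max).+1.
Proof.
move/avoids132P=> av; apply/is_cutP => a b; set p := s^-1%g ord_max.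
have sp : s p = n :> nat by rewrite permKV.
move=> apb; have := av a p b; have := ltn_ord (s b).
have := @perm_nat_neq _ s a b; have := @perm_nat_neq _ s p b.
have [->|ap] := eqVneq a p; first by lia.
have : a != p :> nat by [].
by lia.
Qed.

Lemma is_cut_le_max (n : nat) (s : 'S_n.+1) (i : nat) :
  is_cut s i -> i <= s^-1%g ord_max -> i = 0.
Proof.
case: i => // i /is_cutP/(_ ord0 (s^-1%g ord_max)) /=.
by rewrite permKV /= => H /H; have := ltn_ord (s ord0); lia.
Qed.

Lemma classC_avoids132 (n : nat) (s : 'S_n) : s \in classC n -> avoids132 s.
Proof. by rewrite inE; case/andP. Qed.

Lemma in_active_sites (n : nat) (s : 'S_n.+1) (i : 'I_n.+2) :
  s \in classC n.+1 ->
  (i \in active_sites s) = is_cut s i && (i != (s^-1%g ord_max).+1 :> nat).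
Proof. by move=> sC; rewrite inE classC_insert_max sC. Qed.

Lemma active_sites0 (n : nat) (s : 'S_n.+1) :
  s \in classC n.+1 -> ord0 \in active_sites s.
Proof. by move=> sC; rewrite in_active_sites // is_cut0. Qed.

Lemma card_cuts (n : nat) (s : 'S_n.+1) :
  s \in classC n.+1 -> #|cuts s| = #|active_sites s|.+1.
Proof.
move=> sC; have avs := classC_avoids132 sC.
(* [lift ord0 p] is the site [p+1], the only inactive cut. *)
rewrite (cardsD1 (lift ord0 (s^-1%g ord_max))) inE is_cut_max //; congr _.+1.
by apply: eq_card => i; rewrite in_active_sites // !inE andbC.
Qed.

(** The new permutation has one inactive cut. It is balanced by the cut 0, so only the surviving
    cuts [j >= i] are counted. *)
Lemma card_active_insert (n : nat) (s : 'S_n.+1) (i : 'I_n.+2) :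
  i \in active_sites s ->
  #|active_sites (insert_max s i)| = #|[set j in cuts s | i <= j]|.
Proof.
rewrite inE => iC; apply: succn_inj; rewrite -(card_cuts iC).
have -> : cuts (insert_max s i) =
    ord0 |: lift ord0 @: [set j in cuts s | i <= j].
  apply/setP => j; rewrite !inE; case: (unliftP ord0 j) => [j'|] ->; last first.
    by rewrite is_cut0.
  rewrite (mem_imset _ _ lift_inj) !inE /= /bump /= add1n.
  case: (leqP i j') => [ij|ji]; first by rewrite is_cut_insert_maxS ?andbT.
  by rewrite andbF; apply/negP => /is_cut_insert_max/(_ ji).
rewrite cardsU1 (card_imset _ lift_inj); case: imsetP => // -[x _].
by move/(congr1 val).
Qed.

(** All cuts survive insertion at site 0; the inactive cut of [s] thus enters the count and gives
    the extra one. *)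
Lemma card_active_insert0 (n : nat) (s : 'S_n.+1) :
  s \in classC n.+1 ->
  #|active_sites (insert_max s ord0)| = #|active_sites s|.+1.
Proof.
move=> sC; rewrite (card_active_insert (active_sites0 sC)) -card_cuts //.
by apply: eq_card => j; rewrite inE andbT.
Qed.

(** An active [i > 0] lies strictly beyond the inactive cut [p+1], so every cut from [i] on is
    active. *)
Lemma card_active_insert_pos (n : nat) (s : 'S_n.+1) (i : 'I_n.+2) :
  s \in classC n.+1 -> i \in active_sites s -> 0 < i ->
  #|active_sites (insert_max s i)| = #|[set j in active_sites s | i <= j]|.
Proof.
move=> sC iA i0; rewrite card_active_insert //; apply: eq_card => j.
rewrite inE [RHS]inE in_active_sites // [j \in cuts s]inE.
case: (leqP i j) => ij; last by rewrite !andbF.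
rewrite !andbT; case: (is_cut s j) => //=.
move: iA; rewrite in_active_sites // => /andP[/is_cut_le_max le_max].
by lia.
Qed.

(** * Active sites in increasing order, matched with the succession rule *)

Lemma count_ge_nth (r : nat) (t : seq nat) :
  sorted ltn t -> r < size t -> count (leq (nth 0 t r)) t = size t - r.
Proof.
elim: t r => [|x t IH] [|r] //= xt rt.
  rewrite leqnn subn0; congr _.+1; apply/eqP; rewrite -all_count.
  by apply: sub_all (order_path_min ltn_trans xt) => y /ltnW.
rewrite IH ?(path_sorted xt) // leqNgt.
by rewrite (allP (order_path_min ltn_trans xt)) // mem_nth.
Qed.

Lemma sorted_enum_set (n : nat) (A : {set 'I_n}) :
  sorted ltn (map val (enum A)).
Proof.
rewrite -[enum _](eq_filter (mem_enum _)).
rewrite -(eq_filter (mem_map val_inj _)) -filter_map.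
by rewrite (sorted_filter ltn_trans) // -enumT val_enum_ord iota_ltn_sorted.
Qed.

Lemma card_ge_nth (n : nat) (A : {set 'I_n.+1}) (r : nat) :
  r < #|A| -> #|[set j in A | nth ord0 (enum A) r <= j]| = #|A| - r.
Proof.
move=> rA; have rA' : r < size (enum A) by rewrite -cardE.
have := count_ge_nth (sorted_enum_set A); rewrite size_map -cardE.
move=> /(_ r rA) <-; rewrite (nth_map ord0) // count_map.
rewrite -sum1_count big_enum_cond /= -sum1_card.
by apply: eq_bigl => j; rewrite inE.
Qed.

(** Listing the sites from left to right makes the index of a child in [omega_rule] the index of its
    insertion site. *)
Definition nth_site (n : nat) (s : 'S_n) (r : nat) : 'I_n.+1 :=
  nth ord0 (enum (active_sites s)) r.

Lemma nth_site_active (n : nat) (s : 'S_n) (r : nat) :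
  r < #|active_sites s| -> nth_site s r \in active_sites s.
Proof. by move=> rs; rewrite -mem_enum mem_nth // -cardE. Qed.

Lemma nth_site_surj (n : nat) (s : 'S_n) (i : 'I_n.+1) :
  i \in active_sites s -> exists2 r, r < #|active_sites s| & nth_site s r = i.
Proof.
move=> iA; exists (index i (enum (active_sites s))).
  by rewrite cardE index_mem mem_enum.
by rewrite /nth_site nth_index // mem_enum.
Qed.

Lemma nth_site_inj (n : nat) (s : 'S_n) (q r : nat) :
  q < #|active_sites s| -> r < #|active_sites s| ->
  nth_site s q = nth_site s r -> q = r.
Proof.
by rewrite cardE => qs rs /eqP; rewrite nth_uniq ?enum_uniq // => /eqP.
Qed.

Lemma nth_site0 (n : nat) (s : 'S_n.+1) :
  s \in classC n.+1 -> nth_site s 0 = ord0.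
Proof.
move=> sC; rewrite /nth_site.
rewrite -[enum _](eq_filter (mem_enum _)) -enumT enum_ordSl /=.
by rewrite mem_enum active_sites0.
Qed.

Lemma size_omega_rule (k : nat) : 0 < k -> size (omega_rule k) = k.
Proof. by case: k => // k _; rewrite /omega_rule /= size_rev size_iota. Qed.

Lemma nth_omega_ruleS (k r : nat) :
  r.+1 < k -> nth 0 (omega_rule k) r.+1 = k - r.+1.
Proof.
move=> rk; rewrite /omega_rule /= nth_rev ?size_iota; last by lia.
by rewrite nth_iota; lia.
Qed.

Lemma card_active_nth_site (n : nat) (s : 'S_n.+1) (r : nat) :
  s \in classC n.+1 -> r < #|active_sites s| ->
  #|active_sites (insert_max s (nth_site s r))| =
  nth 0 (omega_rule #|active_sites s|) r.
Proof.
move=> sC; case: r => [|r] rk; first by rewrite nth_site0 // card_active_insert0.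
rewrite nth_omega_ruleS // card_active_insert_pos ?nth_site_active //.
  by rewrite card_ge_nth.
(* Site 0 already has index 0, so a site of index [r.+1] is not 0. *)
rewrite lt0n; apply/negP => /eqP r0.
have k0 : 0 < #|active_sites s| by lia.
suff : 0 = r.+1 by [].
by apply: (nth_site_inj k0 rk); apply: val_inj; rewrite nth_site0.
Qed.

(** * Insertion of the maximum as a bijection *)

Lemma insert_max_inj (n : nat) (s t : 'S_n) (i j : 'I_n.+1) :
  insert_max s i = insert_max t j -> s = t /\ i = j.
Proof.
move=> st; have ij : i = j by rewrite -(insert_max_inv s i) st insert_max_inv.
split=> //; apply/permP => a; apply: val_inj => /=.
by rewrite -(insert_max_lift s i) st ij insert_max_lift.
Qed.

Lemma insert_max_onto (n : nat) (t : 'S_n.+1) :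
  exists s i, t = insert_max s i.
Proof.
pose f (u : 'S_n * 'I_n.+1) := insert_max u.1 u.2.
have f_inj : injective f.
  by case=> [s i] [s' i'] /insert_max_inj[/= -> ->].
(* Surjectivity by counting, as [n! * (n+1) = (n+1)!]; no deletion map has to be built. *)
have : t \in codom f.
  by apply: inj_card_onto => //; rewrite card_prod !card_Sn card_ord factS mulnC.
by case/codomP => [[s i] ->]; exists s, i.
Qed.

(** * Coding the nodes of the tree *)

(* A node of level n has a path of length n-1.  The missing n-th index is read as
   0, i.e. the insertion of 2 at the first site of 1, so the root gets 21. *)
Fixpoint perm_of_path (n : nat) (p : seq nat) : 'S_n.+1 :=
  if n is m.+1 then
    let s := perm_of_path m (behead p) in insert_max s (nth_site s (head 0 p))
  else 1%g.

Definition code (n : nat) (x : node omega_rule 2 n) : 'S_n.+1 :=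
  perm_of_path n (val x).

Lemma classC1 : (1%g : 'S_1) \in classC 1.
Proof.
rewrite inE; apply/andP; split.
  by apply/avoids132P => i j k; rewrite !ord1.
by apply/has_succ_factorP => -[i [j []]]; rewrite !ord1.
Qed.

Lemma card_active1 : #|active_sites (1%g : 'S_1)| = 1.
Proof.
apply/eqP/cards1P; exists ord0; apply/setP => i.
rewrite (in_active_sites _ classC1) inE ord1.
(* Site 1 is the one just after the maximum, where the insertion would give 12. *)
case: (unliftP ord0 i) => [j|] ->; last by rewrite is_cut0.
by rewrite (ord1 j) andbF.
Qed.

Lemma perm_of_path1 : perm_of_path 1 [::] = perm21.
Proof.
rewrite /= nth_site0 ?classC1 //; apply/permP => x; apply: val_inj => /=.
case: (unliftP ord0 x) => [j|] ->.
  rewrite insert_max_lift !ord1 (_ : lift _ _ = ord_max) ?tpermR //.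
  exact: val_inj.
by rewrite insert_max_site tpermL.
Qed.

Lemma is_node_cons (rule : nat -> seq nat) (root r : nat) (p : seq nat) :
  is_node rule root (r :: p) =
  is_node rule root p && (r < size (rule (path_label rule root p))).
Proof. by []. Qed.

Lemma active_sites_gt0 (n : nat) (s : 'S_n.+1) :
  s \in classC n.+1 -> 0 < #|active_sites s|.
Proof. by move/active_sites0 => A0; apply/card_gt0P; exists ord0. Qed.

(** The two claims need a joint induction: the label claim turns the bound on a child index into a
    bound by the number of active sites, and class membership makes that number positive and lets
    the rule apply. *)
Lemma path_spec (p : seq nat) (n := (size p).+1) (s := perm_of_path n p) :
  is_node omega_rule 2 p ->
  s \in classC n.+1 /\ #|active_sites s| = path_label omega_rule 2 p.
Proof.
rewrite {}/s {}/n; elim: p => [_|r p IH].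
  have A0 := active_sites0 classC1.
  rewrite /= nth_site0 ?classC1 // (card_active_insert0 classC1) card_active1.
  by move: A0; rewrite inE.
rewrite is_node_cons => /andP[/IH[]].
set s := perm_of_path _ p => sC es; rewrite -es.
rewrite size_omega_rule ?active_sites_gt0 // => rk.
split; first by move: (nth_site_active rk); rewrite inE.
by rewrite [RHS]/path_label -/path_label -es -card_active_nth_site.
Qed.

Lemma node_path (n : nat) (x : node omega_rule 2 n) :
  is_node omega_rule 2 (val x) /\ (size (val x)).+1 = n.
Proof. by case: x => p /= /andP[? /eqP]. Qed.

Lemma code_classC (n : nat) (x : node omega_rule 2 n) : code x \in classC n.+1.
Proof. by case: (node_path x) => /path_spec[+ _] e; rewrite /code e. Qed.

Lemma code_label (n : nat) (x : node omega_rule 2 n) :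
  label x = #|active_sites (code x)|.
Proof.
by case: (node_path x) => /path_spec[_ +] e; rewrite /code /label e => ->.
Qed.

Lemma node_cons (n : nat) (x : node omega_rule 2 n) (r : nat) :
  r < #|active_sites (code x)| ->
  exists y : node omega_rule 2 n.+1, val y = r :: val x.
Proof.
move=> rk; have [xN xn] := node_path x.
have yP : is_node omega_rule 2 (r :: val x) && ((size (r :: val x)).+1 == n.+1).
  rewrite is_node_cons xN [size (r :: _)]/= xn eqxx andbT andTb.
  rewrite -[path_label _ _ _]/(label x) code_label.
  by rewrite size_omega_rule ?active_sites_gt0 ?code_classC.
by exists (exist _ (r :: val x) yP).
Qed.

Lemma node_uncons (n : nat) (y : node omega_rule 2 n.+2) :
  exists2 x : node omega_rule 2 n.+1,
    val y = head 0 (val y) :: val x &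
    head 0 (val y) < #|active_sites (code x)|.
Proof.
case: y => -[|r p] // yP; case/andP: (yP).
rewrite is_node_cons => /andP[pN rk] /eqP[pn].
have xP : is_node omega_rule 2 p && ((size p).+1 == n.+1) by rewrite pN pn eqxx.
exists (exist _ p xP) => //.
move: rk.
rewrite -[path_label _ _ _]/(label (exist _ p xP : node omega_rule 2 n.+1)).
by rewrite code_label size_omega_rule ?active_sites_gt0 ?code_classC.
Qed.

Lemma code_cons (n r : nat) (x : node omega_rule 2 n)
    (y : node omega_rule 2 n.+1) :
  val y = r :: val x -> code y = insert_max (code x) (nth_site (code x) r).
Proof. by rewrite /code /= => ->. Qed.

Lemma code_inj (n : nat) : injective (@code n).
Proof.
(* Level 0 is empty and level 1 has only the empty path. Beyond that, the last insertion determines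
   the code of the parent and the site. *)
elim: n => [|[|n] IH] x y; first by case: (node_path x).
  move=> _; apply: val_inj.
  have [_] := node_path x; have [_] := node_path y.
  by case: (val x) (val y) => [|? ?] [|? ?].
have [x' ex qx] := node_uncons x; have [y' ey qy] := node_uncons y.
rewrite (code_cons ex) (code_cons ey) => /insert_max_inj[/IH exy].
rewrite -{}exy in ey qy * => /(nth_site_inj qx qy) eh.
by apply: val_inj; rewrite ex ey eh.
Qed.

Lemma code_onto (n : nat) (s : 'S_n.+2) :
  s \in classC n.+2 -> exists x : node omega_rule 2 n.+1, code x = s.
Proof.
elim: n s => [|n IH] s sC; have [t [i est]] := insert_max_onto s;
  move: (sC); rewrite est classC_insert_max => /and3P[tC ci ip].
  (* At level 1 the permutation of length 1 has a single active site, so only the root can occur. *)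
  have t1 : t = 1%g by apply/permP => a; rewrite !ord1.
  have /card_le1_eqP le1 : #|active_sites t| <= 1 by rewrite t1 card_active1.
  have i0 : i = ord0.
    by apply: le1; rewrite in_active_sites ?is_cut0 ?ci.
  exists (root_node omega_rule 2).
  by rewrite /code /= nth_site0 ?classC1 // t1 i0.
have [x ex] := IH t tC.
have iA : i \in active_sites (code x) by rewrite inE ex -est.
have [r rk ri] := nth_site_surj iA; have [y ey] := node_cons rk.
by exists y; rewrite (code_cons ey) ri ex.
Qed.

Theorem theorem5 :
  exists code : forall n : nat, node omega_rule 2 n -> 'S_n.+1,
    [/\ code 1 (root_node omega_rule 2) = perm21,
        forall (n : nat) (x : node omega_rule 2 n),
          label x = #|active_sites (code n x)|,
        forall (n : nat) (x : node omega_rule 2 n) (s : 'S_n.+2),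
          (exists y : node omega_rule 2 n.+1, child_of y x /\ code n.+1 y = s)
          <-> (exists i : 'I_n.+2,
                 i \in active_sites (code n x) /\ s = insert_max (code n x) i)
      & forall n : nat, 1 <= n ->
          injective (code n) /\
          (forall s : 'S_n.+1,
             s \in classC n.+1 <-> exists x : node omega_rule 2 n, code n x = s)].
Proof.
exists code; split.
- exact: perm_of_path1.
- exact: code_label.
- move=> n x s; split=> [[y [[r ey] <-]]|[i [iA ->]]].
    exists (nth_site (code x) r); rewrite (code_cons ey); split=> //.
    (* Since [y] is a node, its last index is below the label of [x]. *)
    apply: nth_site_active; rewrite -code_label.
    have [+ _] := node_path y; rewrite ey is_node_cons => /andP[_].
    rewrite size_omega_rule // [path_label _ _ _]code_label.
    by rewrite active_sites_gt0 ?code_classC.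
  have [r rk ri] := nth_site_surj iA; have [y ey] := node_cons rk.
  by exists y; split; [exists r | rewrite (code_cons ey) ri].
case=> // n _; split; first exact: code_inj.
by move=> s; split=> [/code_onto // | [x <-]]; apply: code_classC.
Qed.
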